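(* Let $n\geq 1$. The monoid $\mathcal{IO}_n^-$ is defined by the monoid presentation $\langle A\mid R^-\rangle$ on $n-1$ generators and $\frac{1}{2}(n^2-n)$ relations, where $A=\{a_1,\ldots,a_{n-1}\}$ is an alphabet with $n-1$ letters and $R^-$ is the following set of relations on $A^*$: $(R_1)$ $a_ia_{n-1}=a_i$, for $1\leq i\leq n-1$; $(R_2)$ $a_ia_j=a_{j+1}a_i$, for $1\leq i\leq j\leq n-2$.
   Context: Let $\Omega_n=\{1,\ldots,n\}$ with the usual linear order. Transformations of $\Omega_n$ are written on the right of their arguments and composed from left to right: $x(\alpha\beta)=(x\alpha)\beta$. $\mathcal{IO}_n$ is the monoid, under composition, of all full transformations $\alpha:\Omega_n\to\Omega_n$ that are order-preserving ($x\leq y$ implies $x\alpha\leq y\alpha$) and whose image is an interval of $\Omega_n$ (if $x\leq y\leq z$ and $x,z\in\mathrm{Im}(\alpha)$ then $y\in\mathrm{Im}(\alpha)$). $\mathcal{IO}_n^-$ is the submonoid of those $\alpha\in\mathcal{IO}_n$ with $x\alpha\leq x$ for all $x\in\Omega_n$. A monoid presentation $\langle C\mid S\rangle$ consists of an alphabet $C$ and a set $S\subseteq C^*\times C^*$ of relations on the free monoid $C^*$, a pair $(u,v)$ being written $u=v$; $\sim_S$ denotes the smallest congruence on $C^*$ containing $S$. A monoid $M$ is defined by the presentation $\langle C\mid S\rangle$ if $M$ is isomorphic to $C^*/\sim_S$. (In this result the letter $a_i$ represents the transformation of $\Omega_n$ with $xa_i=x$ for $x\leq i$ and $xa_i=x-1$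 for $x\geq i+1$. For $n=1$ the alphabet and the set of relations are empty.) *)

(* Defs.v *)
From HB Require Import structures.
From mathcomp Require Import all_boot.
From mathcomp Require Import boolp classical_sets functions cardinality.

Set Implicit Arguments.
Unset Strict Implicit.
Unset Printing Implicit Defensive.

(* Monoid presentations *)

Definition word (C : Type) : Type := seq C.

HB.instance Definition _ (C : choiceType) := Choice.copy (word C) (seq C).

HB.instance Definition _ (C : choiceType) :=
  isMonoid.Build (word C) (@catA C) (@cat0s C) (@cats0 C).

Section Presentation.
Variable C : choiceType.
Implicit Types S E : set (word C * word C).

Definition congruence E : Prop :=
  [/\ forall u, E (u, u),
      forall u v, E (u, v) -> E (v, u),
      forall u v w, E (u, v) -> E (v, w) -> E (u, w)
    & forall u u' v v', E (u, u') -> E (v, v') -> E (u * v, u' * v')%g].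

Definition congruence_generated_by S : set (word C * word C) :=
  smallest congruence S.

Lemma congruence_generated_byP S : congruence (congruence_generated_by S).
Proof.
split.
- by move=> u E [[Er _ _ _] _]; apply: Er.
- by move=> u v Suv E EP; case: (EP) => -[_ Es _ _] _; apply/Es/(Suv E EP).
- move=> u v w Suv Svw E EP; case: (EP) => -[_ _ Et _] _.
  exact: Et (Suv E EP) (Svw E EP).
- move=> u u' v v' Su Sv E EP; case: (EP) => -[_ _ _ Em] _.
  exact: Em (Su E EP) (Sv E EP).
Qed.

Definition congb S : rel (word C) :=
  fun u v => `[< congruence_generated_by S (u, v) >].

Fact congb_refl S : reflexive (congb S).
Proof. by move=> u; apply/asboolP; case: (congruence_generated_byP S). Qed.

Fact congb_sym S : symmetric (congb S).
Proof.
by move=> u v; case: (congruence_generated_byP S) => _ Ss _ _;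
  apply/asboolP/asboolP; apply: Ss.
Qed.

Fact congb_trans S : transitive (congb S).
Proof.
move=> v u w /asboolP Suv /asboolP Svw; apply/asboolP.
by case: (congruence_generated_byP S) => _ _ St _; apply: St Suv Svw.
Qed.

Canonical congb_equiv S :=
  EquivRel (congb S) (@congb_refl S) (@congb_sym S) (@congb_trans S).

Local Open Scope quotient_scope.

(* The quotient C^* / ~_S *)
Definition presented_monoid S : Type := {eq_quot congb_equiv S}.

HB.instance Definition _ S := Choice.copy (presented_monoid S)
  {eq_quot congb_equiv S}.
HB.instance Definition _ S := EqQuotient.copy (presented_monoid S)
  {eq_quot congb_equiv S}.

Definition class_of S (w : word C) : presented_monoid S :=
  \pi_(presented_monoid S) w.

Lemma class_ofP S u v :
  class_of S u = class_of S v <-> congruence_generated_by S (u, v).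
Proof.
split=> [/eqP|Suv]; last apply/eqP; rewrite /class_of.
  by rewrite (eqmodE (congb_equiv S)) => /asboolP.
by rewrite (eqmodE (congb_equiv S)); apply/asboolP.
Qed.

Definition presented_mul S (x y : presented_monoid S) : presented_monoid S :=
  class_of S (repr x * repr y)%g.

Lemma class_of_repr S (x : presented_monoid S) : class_of S (repr x) = x.
Proof. exact: reprK. Qed.

Lemma class_ofM S u v :
  presented_mul (class_of S u) (class_of S v) = class_of S (u * v)%g.
Proof.
apply/class_ofP; case: (congruence_generated_byP S) => _ _ _ Sm.
by apply: Sm; apply/class_ofP; rewrite class_of_repr.
Qed.

Fact presented_mulA S : associative (@presented_mul S).
Proof.
move=> x y z; rewrite -(class_of_repr x) -(class_of_repr y) -(class_of_repr z).
by rewrite !class_ofM mulgA.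
Qed.

Fact presented_mul1 S : left_id (class_of S 1%g) (@presented_mul S).
Proof. by move=> x; rewrite -(class_of_repr x) class_ofM mul1g. Qed.

Fact presented_mulr1 S : right_id (class_of S 1%g) (@presented_mul S).
Proof. by move=> x; rewrite -(class_of_repr x) class_ofM mulg1. Qed.

HB.instance Definition _ S := isMonoid.Build (presented_monoid S)
  (@presented_mulA S) (@presented_mul1 S) (@presented_mulr1 S).

(* M is defined by the presentation < C | S >, the letter c representing the
   element g c of M. *)
Definition defined_by (M : monoidType) S (g : C -> M) : Prop :=
  exists f : presented_monoid S -> M,
    [/\ monoid_morphism f, bijective f & forall c, f (class_of S [:: c]) = g c].

End Presentation.

(* Transformations of Omega_n; the point k of {1, ..., n} is the element k - 1
   of 'I_n. *)

Definition transf (n : nat) : Type := {ffun 'I_n -> 'I_n}.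

HB.instance Definition _ n := Finite.copy (transf n) {ffun 'I_n -> 'I_n}.

(* Transformations act on the right: x(ab) = (xa)b. *)
Definition transf_mul n (a b : transf n) : transf n := [ffun x => b (a x)].
Definition transf_one n : transf n := [ffun x => x].

Fact transf_mulA n : associative (@transf_mul n).
Proof. by move=> a b c; apply/ffunP => x; rewrite !ffunE. Qed.

Fact transf_mul1 n : left_id (@transf_one n) (@transf_mul n).
Proof. by move=> a; apply/ffunP => x; rewrite !ffunE. Qed.

Fact transf_mulr1 n : right_id (@transf_one n) (@transf_mul n).
Proof. by move=> a; apply/ffunP => x; rewrite !ffunE. Qed.

HB.instance Definition _ n := isMonoid.Build (transf n)
  (@transf_mulA n) (@transf_mul1 n) (@transf_mulr1 n).

Definition order_preserving n (a : transf n) : bool :=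
  [forall x : 'I_n, forall y : 'I_n, (x <= y) ==> (a x <= a y)].

Definition interval_image n (a : transf n) : bool :=
  [forall x : 'I_n, forall y : 'I_n, forall z : 'I_n,
    [&& x <= y, y <= z, x \in codom a & z \in codom a] ==> (y \in codom a)].

Definition in_IO n : pred (transf n) :=
  fun a => order_preserving a && interval_image a.

Lemma order_preservingP n (a : transf n) :
  reflect (forall x y : 'I_n, x <= y -> a x <= a y) (order_preserving a).
Proof.
by apply: (iffP forallP) => [a_op x y|a_op x];
  [apply/implyP; apply: (forallP (a_op x)) | apply/forallP => y; apply/implyP/a_op].
Qed.

Lemma interval_imageP n (a : transf n) :
  reflect (forall x y z : 'I_n, x <= y -> y <= z ->
             x \in codom a -> z \in codom a -> y \in codom a)
          (interval_image a).
Proof.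
apply: (iffP forallP) => [aI x y z xy yz ax az|aI x].
  have /forallP /(_ y) /forallP /(_ z) := aI x.
  by rewrite xy yz ax az.
apply/forallP => y; apply/forallP => z; apply/implyP => /and4P[].
exact: aI.
Qed.

Fact in_IO_monoid_closed n : monoid_closed (@in_IO n).
Proof.
split.
  rewrite unfold_in; apply/andP; split.
    by apply/order_preservingP => x y xy; rewrite !ffunE.
  apply/interval_imageP => x y z _ _ _ _.
  by apply/codomP; exists y; rewrite ffunE.
move=> a b; rewrite !unfold_in => /andP[/order_preservingP aO /interval_imageP aI].
move=> /andP[/order_preservingP bO /interval_imageP bI]; apply/andP; split.
  by apply/order_preservingP => x y xy; rewrite !ffunE; apply/bO/aO.
apply/interval_imageP => x y z xy yz xab zab.
have [->//|nyx] := eqVneq y x; have [->//|nyz] := eqVneq y z.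
move: xab zab => /codomP[x' xE] /codomP[z' zE]; rewrite !ffunE in xE zE.
have : y \in codom b by apply: (bI x _ z) => //; rewrite ?xE ?zE codom_f.
case/codomP=> w yE.
have xw : a x' <= w.
  rewrite leqNgt; apply/negP => /ltnW/bO; rewrite -yE -xE => yx.
  by case/negP: nyx; rewrite -val_eqE /= eqn_leq yx xy.
have wz : w <= a z'.
  rewrite leqNgt; apply/negP => /ltnW/bO; rewrite -yE -zE => zy.
  by case/negP: nyz; rewrite -val_eqE /= eqn_leq yz zy.
have /codomP[v wE] : w \in codom a by apply: (aI _ _ _ xw wz); apply: codom_f.
by apply/codomP; exists v; rewrite ffunE -wE.
Qed.

(* The monoid IO_n *)
Record IO (n : nat) : Type := MkIO { IOval :> transf n; _ : in_IO IOval }.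

HB.instance Definition _ n := [isSub for @IOval n].
HB.instance Definition _ n := [Finite of IO n by <:].
HB.instance Definition _ n := SubChoice_isSubMonoid.Build
  (transf n) (@in_IO n) (IO n) (@in_IO_monoid_closed n).

Definition decreasing n : pred (IO n) :=
  fun a => [forall x : 'I_n, (a : transf n) x <= x].

Fact decreasing_monoid_closed n : monoid_closed (@decreasing n).
Proof.
split; first by apply/forallP => x; rewrite ffunE.
move=> a b /forallP aD /forallP bD; apply/forallP => x.
by rewrite ffunE; apply: leq_trans (bD _) (aD x).
Qed.

(* The submonoid IO_n^- of IO_n *)
Record IOminus (n : nat) : Type :=
  MkIOminus { IOminus_val :> IO n; _ : decreasing IOminus_val }.

HB.instance Definition _ n := [isSub for @IOminus_val n].
HB.instance Definition _ n := [Finite of IOminus n by <:].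
HB.instance Definition _ n := SubChoice_isSubMonoid.Build
  (IO n) (@decreasing n) (IOminus n) (@decreasing_monoid_closed n).

(* The alphabet A = {a_1, ..., a_(n-1)}: the letter a_k is k - 1 in 'I_n.-1.
   Since points and indices are both shifted by one, the formula for x a_i is
   unchanged. *)
Notation letter n := 'I_n.-1.

Fact gen_subproof n (x : 'I_n) : x.-1 < n.
Proof. exact: leq_ltn_trans (leq_pred x) (ltn_ord x). Qed.

Definition gen_transf n (i : letter n) : transf n :=
  [ffun x : 'I_n => if x <= i then x else Ordinal (gen_subproof x)].

Fact gen_in_IO n (i : letter n) : in_IO (gen_transf i).
Proof.
apply/andP; split.
  apply/order_preservingP => x y xy; rewrite !ffunE.
  case: (leqP x i) => xi; case: (leqP y i) => yi //=.
  - by rewrite -ltnS prednK ?(leq_ltn_trans xi) // (leq_ltn_trans _ yi).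
  - by rewrite leqNgt in xy; case/negP: xy; apply: leq_ltn_trans yi xi.
  - by rewrite -!subn1 leq_sub2r.
apply/interval_imageP => x y z _ yz _ /codomP[z' zE].
have [yi|iy] := leqP y i.
  by apply/codomP; exists y; rewrite ffunE yi.
have {}zE : y.+1 < n.
  move: yz; rewrite zE ffunE; case: (leqP z' i) => z'i /=.
    by move=> yz'; have := leq_trans iy (leq_trans yz' z'i); rewrite ltnn.
  move=> yz; apply: leq_ltn_trans (ltn_ord z').
  by rewrite -[X in _ <= X]prednK ?(leq_ltn_trans _ z'i).
apply/codomP; exists (Ordinal zE); rewrite ffunE /= leqNgt ltnS (ltnW iy) /=.
exact: val_inj.
Qed.

Fact gen_decreasing n (i : letter n) : decreasing (MkIO (gen_in_IO i)).
Proof.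
by apply/forallP => x; rewrite ffunE; case: ifP => //= _; exact: leq_pred.
Qed.

Definition gen n (i : letter n) : IOminus n := MkIOminus (gen_decreasing i).

Local Open Scope classical_set_scope.

(* k is the letter a_(n-1). *)
Definition R1 n : set (word (letter n) * word (letter n)) :=
  [set r | exists i k : letter n,
     val k = n.-2 /\ r = ([:: i; k], [:: i])].

Arguments R1 : clear implicits.

(* j' is the letter a_(j+1); its existence forces j <= n - 2. *)
Definition R2 n : set (word (letter n) * word (letter n)) :=
  [set r | exists i j j' : letter n,
     [/\ (val i <= val j)%N, val j' = (val j).+1
       & r = ([:: i; j], [:: j'; i])]].

Arguments R2 : clear implicits.

Definition Rminus n : set (word (letter n) * word (letter n)) :=
  R1 n `|` R2 n.

Arguments Rminus : clear implicits.

(* Main.v *)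
Require Import Defs.
From mathcomp Require Import all_boot.
From mathcomp Require Import boolp classical_sets functions cardinality.

Local Open Scope classical_set_scope.
Local Open Scope card_scope.

(* Read from left to right, (R_2) and (R_1) turn a word a_i w, with w strictly
   decreasing, into a strictly decreasing word.  A strictly decreasing word acts
   on Omega_n so that the points i and i + 1 are identified exactly when a_i
   occurs in it, and an element of IO_n^- is determined by the set of those i,
   because its image is an interval.  The relations correspond one-to-one to the
   pairs i <= j of letters. *)

Definition word_eval {C : Type} {M : monoidType} (g : C -> M)
    (w : word C) : M :=
  (\big[*%g/1]_(c <- w) g c)%g.

(** * Presentations from normal forms *)

Section NormalForms.
Variables (C : choiceType) (M : monoidType) (S : set (word C * word C)).
Variable g : C -> M.
Hypothesis relS : forall u v, S (u, v) -> word_eval g u = word_eval g v.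

(** The kernel of evaluation is itself a congruence containing [S]. *)
Lemma word_eval_congruence u v :
  congruence_generated_by S (u, v) -> word_eval g u = word_eval g v.
Proof.
suff sub : congruence_generated_by S
    `<=` [set p | word_eval g p.1 = word_eval g p.2] by move=> /sub.
apply: smallest_sub => [|[u' v'] /relS //]; split=> //=.
  by move=> u' v' w -> ->.
by move=> u1 u2 v1 v2; rewrite /word_eval !big_cat /= => -> ->.
Qed.

(** Evaluation descends to the quotient, and [class_of S (nf a)] provides its two-sided inverse. *)
Lemma defined_by_normal_form (nf : M -> word C) :
    (forall a, word_eval g (nf a) = a) ->
    (forall w, congruence_generated_by S (w, nf (word_eval g w))) ->
  defined_by S g.
Proof.
move=> evalK nfP; pose f (x : presented_monoid S) := word_eval g (repr x).
have fE w : f (class_of S w) = word_eval g w.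
  by apply: word_eval_congruence; apply/class_ofP; rewrite class_of_repr.
exists f; split.
- split=> [|x y]; first by rewrite fE /word_eval big_nil.
  rewrite -(class_of_repr x) -(class_of_repr y).
  rewrite [LHS](congr1 f (class_ofM _ _ _)).
  by rewrite !fE /word_eval big_cat.
- exists (fun a => class_of S (nf a)) => [x|a]; last by rewrite fE.
  by rewrite -[RHS]class_of_repr; apply/esym/class_ofP; exact: nfP.
- by move=> c; rewrite fE /word_eval big_seq1.
Qed.

End NormalForms.

(** * Action of words on points *)

Local Notation act a x := (((a : IOminus _) : transf _) x).

(** Acting on all of [nat] avoids bound proofs for points such as [i.+1]. *)
Definition letter_act {m : nat} (x : nat) (i : 'I_m) : nat := x - (i < x).

Lemma word_evalE {n : nat} (w : word (letter n)) (x : 'I_n) :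
  act (word_eval (@gen n) w) x = foldl letter_act x w :> nat.
Proof.
elim: w x => [|i w IHw] x; first by rewrite /word_eval big_nil ffunE.
rewrite /word_eval big_cons ffunE IHw ffunE /= /letter_act.
by case: leqP => _; rewrite ?subn0 ?subn1.
Qed.

Definition word_desc {m : nat} (w : word 'I_m) : bool := sorted gtn (map val w).

Lemma gtn_trans : transitive gtn.
Proof. by move=> ? ? ? ab bc; apply: ltn_trans bc ab. Qed.

(** A letter [j < x] lowers both points by one, and the next letter, being below [j], is again below
    the lowered points, so they stay consecutive. *)
Lemma letter_act_path {m : nat} (w : word 'I_m) (x : nat) :
  path gtn x (map val w) -> foldl letter_act x.+1 w = (foldl letter_act x w).+1.
Proof.
elim: w x => //= j w IHw x /andP[jx wP]; rewrite /letter_act ltnS (ltnW jx) jx.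
rewrite !subn1 /=; case: x jx => //= x jx; apply: IHw.
case: w wP => //= k w /andP[kj ->]; rewrite andbT.
exact: leq_trans kj jx.
Qed.

Lemma letter_act_desc {m : nat} (w : word 'I_m) (i : 'I_m) :
  word_desc w -> (foldl letter_act i.+1 w == foldl letter_act i w) = (i \in w).
Proof.
(* Compare [i] with the first letter [j]: if [i < j], both points are fixed by [j]; if [j < i], all
   letters lie below [i] and the points stay apart; if [i = j], the points merge at once. *)
rewrite /word_desc; elim: w => [_|j w IHw]; first by rewrite /= eqn_leq ltnn.
rewrite inE /= => wP; have [ij|ji|/val_inj ->] := ltngtP i j.
- rewrite /letter_act ltnS [j <= i]leqNgt ij [j < i]ltnNge (ltnW ij) !subn0.
  by rewrite IHw ?(path_sorted wP) // -val_eqE ltn_eqF.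
- have := @letter_act_path _ (j :: w) i; rewrite /= ji wP => /(_ isT) ->.
  rewrite eqn_leq ltnn -val_eqE gtn_eqF //=; apply/esym/negbTE/negP => iw.
  have /allP/(_ i) := order_path_min gtn_trans wP.
  by rewrite map_f // => /(_ isT); rewrite /= ltnNge ltnW.
- by rewrite /letter_act leqnn ltnn subn0 subn1 !eqxx.
Qed.

Lemma val_ord_last {m : nat} (j : 'I_m) : m <= j.+1 -> j = m.-1 :> nat.
Proof.
by case: m j => [[]|m] // j mj; apply/eqP; rewrite eqn_leq -ltnS ltn_ord.
Qed.

(** * Elements of the monoid and their decreasing words *)

Section IOminusNormalForm.
Variable m : nat.
Notation lo i := (widen_ord (leqnSn m) i).
Notation hi i := (lift ord0 i).

Definition flat (a : IOminus m.+1) (i : 'I_m) : bool :=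
  act a (lo i) == act a (hi i).

Lemma IOminus_step (a : IOminus m.+1) (i : 'I_m) :
  act a (hi i) = act a (lo i) + ~~ flat a i :> nat.
Proof.
have /andP[/order_preservingP aO /interval_imageP aI] := valP (val a).
have := aO (lo i) (hi i); rewrite /= leqW //= => /(_ isT).
rewrite /flat -val_eqE /= leq_eqVlt.
have [->|_ /= lt_a] := eqVneq; rewrite ?addn0 //.
(* A jump of two or more would skip a value; the image being an interval, some [w] attains it, but
   monotonicity leaves no place for [w] on either side of the jump. *)
apply/eqP; rewrite addn1 eqn_leq lt_a andbT leqNgt; apply/negP => gap.
have yn : (act a (lo i)).+1 < m.+1 by apply: ltn_trans (ltn_ord (act a (hi i))).
have /codomP[w /(congr1 val) /= wE] : Ordinal yn \in codom (val (val a)).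
  by apply: (aI (act a (lo i)) _ (act a (hi i))); rewrite ?codom_f //= ltnW.
have [wi|iw] := leqP w i.
  by have := aO w (lo i) wi; rewrite -wE ltnn.
by have := aO (hi i) w iw; rewrite -wE leqNgt gap.
Qed.

(** The least point is sent to itself because [a] is decreasing, and each later value exceeds the
    previous one by 0 or 1, as [flat] dictates. *)
Lemma IOminus_eq (a b : IOminus m.+1) : flat a =1 flat b -> a = b.
Proof.
move=> ab; do 2!apply: val_inj; apply/ffunP => -[x xn]; apply: val_inj => /=.
elim: x xn => [|x IHx] xn.
  have zero (c : IOminus m.+1) : act c (Ordinal xn) = 0 :> nat.
    by apply/eqP; rewrite -leqn0; have /forallP := valP c.
  by rewrite !zero.
have step (c : IOminus m.+1) :
    act c (Ordinal xn) = act c (Ordinal (ltnW xn))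
                         + ~~ flat c (Ordinal (xn : x < m)) :> nat.
  have := IOminus_step c (Ordinal (xn : x < m)).
  by congr (act c _ = act c _ + _ :> nat); apply: val_inj.
by rewrite !step IHx ab.
Qed.

Definition nf (a : IOminus m.+1) : word 'I_m :=
  rev (filter (flat a) (enum 'I_m)).

Lemma mem_nf (a : IOminus m.+1) (i : 'I_m) : (i \in nf a) = flat a i.
Proof. by rewrite mem_rev mem_filter mem_enum andbT. Qed.

Lemma nf_desc (a : IOminus m.+1) : word_desc (nf a).
Proof.
rewrite /word_desc /nf map_rev rev_sorted sorted_map sorted_filter //.
  exact: relpre_trans ltn_trans.
by rewrite -sorted_map val_enum_ord iota_ltn_sorted.
Qed.

Lemma flat_word_eval (w : word 'I_m) (i : 'I_m) :
  word_desc w -> flat (word_eval (@gen m.+1) w) i = (i \in w).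
Proof.
move=> wD; rewrite /flat -val_eqE /= !word_evalE /= eq_sym.
exact: letter_act_desc.
Qed.

Lemma word_eval_nf (a : IOminus m.+1) : word_eval (@gen m.+1) (nf a) = a.
Proof.
apply: IOminus_eq => i; rewrite -[RHS]mem_nf.
by rewrite flat_word_eval ?nf_desc.
Qed.

Lemma nf_word_eval (w : word 'I_m) :
  word_desc w -> nf (word_eval (@gen m.+1) w) = w.
Proof.
move=> wD; apply: (inj_map val_inj); apply: (irr_sorted_eq gtn_trans ltnn).
- exact: nf_desc.
- exact: wD.
- by apply: eq_mem_map => i; rewrite mem_nf flat_word_eval.
Qed.

Lemma word_eval_Rminus u v :
  Rminus m.+1 (u, v) -> word_eval (@gen m.+1) u = word_eval (@gen m.+1) v.
Proof.
move=> uv; do 2!apply: val_inj; apply/ffunP => x; apply: val_inj.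
rewrite /= !word_evalE /=.
case: uv => [[i [k [kE [-> ->]]]]|[i [j [j' [ij j'E [-> ->]]]]]] /=.
  (* No letter has the last point [m = k.+1] in its image, so [k] fixes whatever [i] produces. *)
  have xk : x - (i < x) <= k.
    have kE' : k.+1 = m by rewrite kE prednK // (leq_ltn_trans _ (ltn_ord k)).
    have xm : x <= m by rewrite -ltnS.
    case: ltnP => [_|xi]; first by rewrite leq_subLR add1n kE'.
    by rewrite subn0 (leq_trans xi) // -ltnS kE' ltn_ord.
  by rewrite /letter_act [k < _]ltnNge xk subn0.
rewrite /letter_act j'E; have [xi|ix] := leqP x i.
  have xj := leq_trans xi ij.
  by rewrite !subn0 ltnNge xj ltnNge leqW // subn0 ltnNge xi subn0.
(* Here [x] is [y.+1] with [i <= y]; both sides give [y] if [y <= j], and [y.-1] otherwise. *)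
case: (nat_of_ord x) ix => // y; rewrite subn1 ltnS /= => iy.
rewrite ltnS; have [yj|jy] := leqP y j; first by rewrite !subn0 ltnS iy subn1.
by rewrite !subn1 /= (leq_ltn_trans ij jy) subn1.
Qed.

(** * Rewriting words to decreasing form *)

Local Notation "u ~ v" :=
  (congruence_generated_by (Rminus m.+1) (u, v)) (at level 70).

(** The letter [i] moves right past every [j >= i]: (R_2) raises [j] by one, which is why the bound
    grows to [b.+1], and (R_1) erases [j] if it is the last letter. It stops before the first
    [j < i]. *)
Lemma insert_letter (w : word 'I_m) (i : 'I_m) (b : nat) :
    i <= b -> path gtn b (map val w) ->
  exists2 w' : word 'I_m, i :: w ~ w' & path gtn b.+1 (map val w').
Proof.
have [Er _ Et Em] := congruence_generated_byP (Rminus m.+1).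
elim: w i b => [|j w IHw] i b ib.
  by exists [:: i] => //=; rewrite andbT.
rewrite /= => /andP[jb wP]; have [ij|ji] := leqP i j; last first.
  by exists [:: i, j & w]; rewrite /= ?ji ?wP ?ltnS ?ib.
have [jlast|j'm] := leqP m j.+1.
  have [||w' iw' w'P] := IHw i j => //.
  exists w'; last first.
    move: w' {iw'} w'P => [|k w'] //= /andP[kj ->].
    by rewrite andbT (leq_trans kj) // ltnW.
  apply: Et iw'; apply: (Em [:: i; j] [:: i] w w) => //.
  apply: sub_gen_smallest; left; exists i, j; split=> //=.
  exact: val_ord_last.
have [||w' iw' w'P] := IHw i j => //.
exists (Ordinal j'm :: w'); last by rewrite /= w'P ltnS jb.
apply: Et (Em [:: Ordinal j'm] _ _ _ (Er _) iw').
apply: (Em [:: i; j] [:: Ordinal j'm; i] w w) => //.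
by apply: sub_gen_smallest; right; exists i, j, (Ordinal j'm).
Qed.

Lemma word_desc_exists (w : word 'I_m) :
  exists2 w' : word 'I_m, w ~ w' & word_desc w'.
Proof.
have [Er _ Et Em] := congruence_generated_byP (Rminus m.+1).
elim: w => [|i w [w' ww' w'D]]; first by exists [::].
(* The bound [m] exceeds every letter, so it suits any decreasing word. *)
have [||v iv vP] := @insert_letter w' i m.
- exact: ltnW.
- by case: w' w'D {ww'} => //= j w' w'D; rewrite ltn_ord.
exists v; last exact: path_sorted vP.
by apply: Et iv; apply: (Em [:: i] [:: i]).
Qed.

Lemma nf_congruence (w : word 'I_m) : w ~ nf (word_eval (@gen m.+1) w).
Proof.
have [w' ww' w'D] := word_desc_exists w.
by rewrite (word_eval_congruence _ _ _ _ word_eval_Rminus _ _ ww') nf_word_eval.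
Qed.

End IOminusNormalForm.

(** * Counting the relations *)

Lemma card_ord_pairs_le (m : nat) :
  #|[pred p : 'I_m * 'I_m | p.1 <= p.2]| = 'C(m.+1, 2).
Proof.
rewrite -bin2_sum big_nat_recl //= add0n big_mkord -sum1_card.
under [LHS]eq_bigl do rewrite inE.
rewrite -(pair_big_dep xpredT (fun i j : 'I_m => i <= j) (fun _ _ => 1)) /=.
(* For fixed [j] there are [j.+1] choices of [i <= j], matching the nonzero terms of the sum for the
   binomial. *)
rewrite (exchange_big_dep xpredT) //=; apply: eq_bigr => j _.
by rewrite (big_ord_narrow (ltn_ord j)) sum1_card card_ord.
Qed.

(* (R_2) when the letter after a_j exists, (R_1) when a_j is the last one. *)
Definition Rminus_pair {m : nat} (p : 'I_m * 'I_m) : word 'I_m * word 'I_m :=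
  if insub p.2.+1 is Some j' then ([:: p.1; p.2], [:: j'; p.1])
  else ([:: p.1; p.2], [:: p.1]).

Lemma Rminus_image (m : nat) :
  Rminus m.+1 = Rminus_pair @` [set p : 'I_m * 'I_m | p.1 <= p.2].
Proof.
apply/seteqP; split => [r|r [[i j] /= ij <-]].
  case=> [[i [k [kE ->]]]|[i [j [j' [ij j'E ->]]]]].
    have ik : i <= k.
      by rewrite kE -ltnS prednK // (leq_ltn_trans _ (ltn_ord i)).
    exists (i, k) => //; rewrite /Rminus_pair insubF //= kE prednK ?ltnn //.
    exact: leq_ltn_trans (ltn_ord i).
  exists (i, j) => //; rewrite /Rminus_pair /= -j'E insubT //= => j'm.
  by congr (_, [:: _; _]); apply: val_inj.
rewrite /Rminus_pair /=; case: insubP => [j' _ j'E|].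
  by right; exists i, j, j'.
rewrite -leqNgt => mj; left; exists i, j; split=> //=.
exact: val_ord_last.
Qed.

Lemma card_Rminus (m : nat) : Rminus m.+1 #= `I_('C(m.+1, 2)).
Proof.
rewrite Rminus_image.
apply: card_eq_trans (inj_card_eq _) _.
  move=> [i j] [i' j'] _ _; rewrite /Rminus_pair /=.
  (* In either case the left-hand word spells out the pair. *)
  by do 2!case: insub => [?|]; case=> -> ->.
rewrite -card_ord_pairs_le.
have -> : [set p : 'I_m * 'I_m | p.1 <= p.2] =
    [set enum_val k | k in [set: 'I_(#|[pred p : 'I_m * 'I_m | p.1 <= p.2]|)]].
  apply/seteqP; split=> [p pP|_ [k _ <-]]; last exact: (enum_valP k).
  by exists (enum_rank_in pP p) => //; rewrite enum_rankK_in.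
apply: card_eq_trans (inj_card_eq _) _; first by move=> ? ? _ _ /enum_val_inj.
exact/card_esym/card_II.
Qed.

Theorem theorem3p6 (n : nat) (hn : (1 <= n)%N) :
  [/\ #|{: letter n}| = (n - 1)%N,
      Rminus n #= `I_((n ^ 2 - n) %/ 2)
    & defined_by (Rminus n) (@gen n)].
Proof.
case: n hn => // m _; split; first by rewrite card_ord subn1.
- have -> : (m.+1 ^ 2 - m.+1) %/ 2 = 'C(m.+1, 2).
    by rewrite bin2 divn2 -mulnn -{3}[m.+1]muln1 -mulnBr subn1.
  exact: card_Rminus.
- exact: (defined_by_normal_form _ _ _ _ (@word_eval_Rminus m) _
    (@word_eval_nf m) (@nf_congruence m)).
Qed.
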